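(* Let $\mathbb{K}$ be a field of characteristic zero and let $I\subset S=\mathbb{K}[x_1,\dots,x_n]$ be an artinian monomial ideal generated in degree $d$. Suppose there exist integers $1\le i<j\le n$ and integers $a,b\ge 0$ such that $x_i^a x_j^b$ divides $m$ for every monomial $m\in S$ of degree $d$ with $m\notin I$. Then for every integer $k$ the multiplication map $$\times (x_i+x_j)^{a+b}: (S/I)_{k-a-b}\longrightarrow (S/I)_k$$ has maximal rank, i.e. it is injective or surjective.
   Context: $S=\mathbb{K}[x_1,\dots,x_n]$ is standard graded (each $x_i$ has degree $1$). ''Generated in degree $d$'' means that all minimal generators of $I$ are homogeneous of degree $d$. ''Artinian'' means $\dim_{\mathbb{K}} S/I<\infty$. Graded components in negative degree are zero. *)

(* Defs.v *)
From HB Require Import structures.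
From mathcomp Require Import all_boot all_order all_algebra ring_quotient.
From mathcomp Require Import mpoly.

Set Implicit Arguments.
Unset Strict Implicit.
Unset Printing Implicit Defensive.

Import GRing.Theory.
Local Open Scope ring_scope.
Local Open Scope quotient_scope.

Definition ideal_span (R : comNzRingType) (A : R -> Prop) (p : R) : Prop :=
  exists s : seq (R * R),
    (forall u, u \in s -> A u.2) /\ p = \sum_(u <- s) u.1 * u.2.

Section MonomialIdeals.
Variables (K : fieldType) (n : nat).

(* Ideals are carried by boolean additive subgroups: this gives access to the
   library quotient {ideal_quot I}, and, unlike the library's idealr, does not force
   I to be proper. Closure under multiplication comes from monomial_ideal. *)
Implicit Types (I : zmodClosed {mpoly K[n]}) (G : 'X_{1..n} -> Prop).

Definition generated_by I G : Prop :=
  forall p, p \in I <->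
    ideal_span (fun q : {mpoly K[n]} => exists2 m, G m & q = 'X_[m]) p.

Definition monomial_ideal I : Prop := exists G, generated_by I G.

Definition minimal_generators I G : Prop :=
  generated_by I G /\
  forall G', (forall m, G' m -> G m) -> generated_by I G' ->
    forall m, G m -> G' m.

Definition generated_in_degree I (d : nat) : Prop :=
  forall G, minimal_generators I G -> forall m, G m -> mdeg m = d.

(* Multiplication by f on S/I; well defined when I is an ideal. *)
Definition quot_mul I (f : {mpoly K[n]}) : {ideal_quot I} -> {ideal_quot I} :=
  lift_op1 {ideal_quot I} ( *%R f).

(* dim_K S/I < oo, a scalar c acting on S/I as multiplication by c%:MP. *)
Definition artinian I : Prop :=
  exists N (e : 'I_N -> {ideal_quot I}), forall q : {ideal_quot I},
    exists c : 'I_N -> K, q = \sum_(t < N) quot_mul (c t)%:MP (e t).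

Definition homog_comp (k : int) (p : {mpoly K[n]}) : Prop :=
  match k with
  | Posz e => p \is e.-homog
  | Negz _ => p = 0
  end.

Definition quot_comp I (k : int) (q : {ideal_quot I}) : Prop :=
  exists2 p, homog_comp k p & q = \pi_{ideal_quot I} p.

Definition mul_injective I (f : {mpoly K[n]}) (s : int) : Prop :=
  forall u v : {ideal_quot I}, quot_comp s u -> quot_comp s v ->
    quot_mul f u = quot_mul f v -> u = v.

Definition mul_surjective I (f : {mpoly K[n]}) (s t : int) : Prop :=
  forall w : {ideal_quot I}, quot_comp t w ->
    exists2 u : {ideal_quot I}, quot_comp s u & quot_mul f u = w.

(* For multiplication by f viewed as a map (S/I)_s -> (S/I)_t. *)
Definition mul_maximal_rank I (f : {mpoly K[n]}) (s t : int) : Prop :=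
  mul_injective I f s \/ mul_surjective I f s t.

End MonomialIdeals.

(* Main.v *)
Require Import Defs.
From mathcomp Require Import all_boot all_order all_algebra ring_quotient.
From mathcomp Require Import mpoly.
From HB Require Import structures.
From mathcomp Require Import zify ring.

Import GRing.Theory.
Local Open Scope ring_scope.

(** The degree [d] separates two easy regimes.  A nonzero homogeneous element
    of [I] has degree at least [d], since every monomial of [I] lies above a
    minimal one and the minimal ones form a minimal generating set.  So for
    [k < d] the target of the map is the polynomial ring itself in degree [k],
    and multiplication by a nonzero polynomial is injective.

    For [k >= d] the map is surjective.  Every monomial of degree [k] is a
    multiple of one of degree [d], so it suffices to write each monomial [m] of
    degree [d] outside [I] as a multiple of [f = (x_i + x_j)^(a+b)] plus an
    element of [I].  By assumption [x_i^a x_j^b] divides [m], and all monomials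
    of degree [d] that it does not divide are in [I].  With the other
    variables and the total degree frozen, this is a question on binary forms:
    modulo [f], can a form be replaced by one in which [x^a y^b] divides no
    monomial?  Dehomogenized ([homogenize]), it asks for a multiple of
    [(X + 1)^(a+b)] whose coefficients in a window [a, ..., a + N] are
    prescribed, the cofactor having degree at most [N].  There are as many
    unknowns as equations, so uniqueness suffices.  The difference of two
    solutions is divisible by [(X + 1)^(a+b)] but has at most [a + b] monomials,
    and in characteristic zero this forces it to vanish ([fewnomial_eq0]). *)

(** * Polynomials with few monomials *)

Lemma natr_inj_pchar0 (K : fieldType) :
  [pchar K] =i pred0 -> injective (fun l => l%:R : K).
Proof.
move=> /pcharf0P charK.
suff le_inj (l e : nat) : l%:R = e%:R :> K -> (l <= e)%N.
  by move=> l e eq_le; apply/eqP; rewrite eqn_leq !le_inj.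
move=> eq_le; apply: contraT; rewrite -ltnNge => lt_el.
have := charK (l - e)%N; rewrite natrB 1?ltnW // eq_le subrr eqxx.
by rewrite subn_eq0 leqNgt lt_el.
Qed.

(** Each monomial can be traded for one order of vanishing at [c]: the operator
    [p |-> X p' - e p] multiplies the coefficient of [X^l] by [l - e], so it
    kills the monomial [X^e], creates none, and lowers the multiplicity of [c]
    by at most one.  Induction shows that it kills [p]; then [p] is a multiple
    of [X^e], which cannot vanish at [c <> 0] unless it is zero. *)
Lemma fewnomial_eq0 (K : fieldType) (charK : [pchar K] =i pred0) (c : K)
    (S : seq nat) (p : {poly K}) :
  c != 0 -> (forall e, p`_e != 0 -> e \in S) ->
  ('X - c%:P) ^+ size S %| p -> p = 0.
Proof.
move=> c_neq0; elim: S p => [|e S IHS] p suppS /=.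
  move=> _; apply/polyP=> l; rewrite coef0; apply/eqP.
  by apply: contraT => /suppS.
move=> /dvdpP [q def_p]; pose p1 := 'X * p^`() - p *+ e.
have coef_p1 l : p1`_l = p`_l * (l%:R - e%:R).
  rewrite coefB coefXM coefMn coef_deriv mulrBr !mulr_natr.
  by case: l => [|l] //=; rewrite mulr0n.
have p1_eq0 : p1 = 0.
  apply: IHS => [l|].
    rewrite coef_p1 mulf_eq0 subr_eq0 negb_or => /andP [/suppS].
    by rewrite inE => /orP [/eqP -> | //]; rewrite eqxx.
  (* One of the [size S + 1] factors [X - c] is lost in the derivative. *)
  rewrite /p1 def_p derivM deriv_exp derivXsubC mul1r /=.
  apply/dvdpP; exists ('X * (q^`() * ('X - c%:P) + q *+ (size S).+1) -
    q * ('X - c%:P) *+ e); rewrite exprS; ring.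
have p_root : p.[c] = 0.
  by rewrite def_p hornerM horner_exp hornerXsubC subrr expr0n mulr0.
have p_mono : p = p`_e *: 'X^e.
  apply/polyP=> l; rewrite coefZ coefXn; case: eqP => [-> | /eqP ne_le].
    by rewrite mulr1.
  move: (coef_p1 l); rewrite p1_eq0 coef0 => /esym/eqP.
  rewrite mulf_eq0 subr_eq0 (inj_eq (natr_inj_pchar0 K charK)) (negbTE ne_le).
  by rewrite orbF mulr0 => /eqP.
move: p_root; rewrite p_mono hornerZ hornerXn => /eqP.
by rewrite mulf_eq0 expf_eq0 (negbTE c_neq0) andbF orbF => /eqP ->;
  rewrite scale0r.
Qed.

(** The map taking [g] of degree at most [N] to the coefficients of
    [('X - c)^(a+b) * g] in the window [a, ..., a + N] is an endomorphism of a
    space of dimension [N + 1].  It is injective: for [g] in the kernel, the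
    product has its exponents among the [a] values below the window and the [b]
    values above it.  The kernel argument spares the determinant of the matrix,
    which for [c = -1] is one of binomial coefficients. *)
Lemma exists_mul_coef_window (K : fieldType) (charK : [pchar K] =i pred0) (c : K)
    (a b N : nat) (h : {poly K}) :
  c != 0 ->
  exists2 g : {poly K}, (size g <= N.+1)%N &
    forall e, (a <= e <= a + N)%N ->
      (('X - c%:P) ^+ (a + b) * g)`_e = h`_e.
Proof.
move=> c_neq0; pose F := ('X - c%:P) ^+ (a + b) : {poly K}.
pose phi (u : 'rV[K]_N.+1) : 'rV[K]_N.+1 :=
  \row_(r < N.+1) (F * rVpoly u)`_(a + r).
have phi_lin : linear phi.
  move=> k u v; apply/rowP=> r; rewrite !mxE linearP /= mulrDr.
  by rewrite -scalerAr coefD coefZ.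
pose phiL := GRing.isLinear.Build _ _ _ _ phi phi_lin.
pose phi' : {linear 'rV[K]_N.+1 -> 'rV[K]_N.+1} := HB.pack phi phiL.
have unitM : lin1_mx phi' \in unitmx.
  rewrite -row_free_unit; apply: inj_row_free => u; rewrite mul_rV_lin1 /=.
  move=> /rowP phi0.
  suff: F * rVpoly u = 0.
    move/eqP; rewrite mulf_eq0 expf_eq0 polyXsubC_eq0 andbF /= => /eqP.
    by move/(congr1 (@poly_rV K N.+1)); rewrite rVpolyK linear0.
  have size_F : size F = (a + b).+1 by rewrite size_exp_XsubC.
  apply: (@fewnomial_eq0 K charK c (iota 0 a ++ iota (a + N).+1 b)) => //.
    move=> e; rewrite mem_cat !mem_iota /=; apply: contraR.
    rewrite negb_or => /andP [le_ae out].
    case: (leqP e (a + N)) => [le_eN | lt_Ne].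
      have lt_r : (e - a < N.+1)%N by lia.
      move: (phi0 (Ordinal lt_r)); rewrite !mxE /=.
      by rewrite subnKC; [move=> -> | lia].
    apply/eqP/nth_default; apply: leq_trans (size_polyMleq _ _) _.
    have := size_poly N.+1 (fun k => if insub k is Some i then u 0 i else 0).
    rewrite size_F -/(rVpoly u); lia.
  by rewrite size_cat !size_iota dvdp_mulr.
pose v := (\row_(r < N.+1) h`_(a + r)) *m invmx (lin1_mx phi').
exists (rVpoly v); first exact: size_poly.
move=> e e_in; have lt_r : (e - a < N.+1)%N by lia.
have : phi' v = \row_(r < N.+1) h`_(a + r) by rewrite -mul_rV_lin1 mulmxKV.
move/rowP/(_ (Ordinal lt_r)); rewrite !mxE /= subnKC //; lia.
Qed.

(** * Homogenization in two elements of an algebra *)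

Definition homogenize {K : fieldType} {A : comAlgType K} (x y : A) (T : nat)
    (q : {poly K}) : A :=
  \sum_(e < T.+1) q`_e *: (x ^+ e * y ^+ (T - e)).

(** The bound on the size makes [homogenize] lose no coefficient of [q]. *)
Lemma homogenize_XsubC (K : fieldType) (A : comAlgType K) (x y : A) (c : K)
    (T : nat) (q : {poly K}) :
  (size q <= T.+1)%N ->
  homogenize x y T.+1 (('X - c%:P) * q) = (x - c *: y) * homogenize x y T q.
Proof.
move=> size_q; rewrite [RHS]mulrBl /homogenize !mulr_sumr.
under eq_bigr do rewrite mulrBl coefB coefXM coefCM scalerBl.
rewrite sumrB; congr (_ - _).
  rewrite big_ord_recl scale0r add0r; apply: eq_bigr => e _.
  by rewrite /= subSS exprS -scalerAr mulrA.
rewrite big_ord_recr /= nth_default // mulr0 scale0r addr0.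
apply: eq_bigr => e _; rewrite subSn -1?ltnS // exprS.
by rewrite -scalerAl -scalerAr scalerA (mulrCA y).
Qed.

Lemma homogenize_XsubC_exp (K : fieldType) (A : comAlgType K) (x y : A) (c : K)
    (T s : nat) (q : {poly K}) :
  (size q <= T.+1)%N ->
  homogenize x y (s + T) (('X - c%:P) ^+ s * q) =
    (x - c *: y) ^+ s * homogenize x y T q.
Proof.
move=> size_q; elim: s => [|s IHs]; first by rewrite !expr0 !mul1r.
rewrite addSn !exprS -!mulrA -IHs homogenize_XsubC //.
apply: leq_trans (size_polyMleq _ _) _; rewrite size_exp_XsubC; lia.
Qed.


(** * Reducing a monomial modulo a power of the sum of two variables *)

Lemma homogenizeX (K : fieldType) (n : nat) (i j : 'I_n) (m : 'X_{1..n})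
    (T : nat) (q : {poly K}) :
  'X_[m] * homogenize ('X_i : {mpoly K[n]}) 'X_j T q =
  \sum_(e < T.+1) q`_e *: 'X_[m + U_(i) *+ e + U_(j) *+ (T - e)].
Proof.
rewrite mulr_sumr; apply: eq_bigr => e _.
by rewrite -scalerAr !mpolyXD -!mpolyXn mulrA.
Qed.

(** All monomials involved agree with [m] outside [x_i] and [x_j], and have the
    same degree as [m], so they are determined by their exponent [e] at [x_i].
    Those divisible by [x_i^a x_j^b] are the ones with [e] in the window
    [a, ..., a + N], and [exists_mul_coef_window] clears that window. *)
Lemma monomial_reduction (K : fieldType) (charK : [pchar K] =i pred0) (n : nat)
    (i j : 'I_n) (a b : nat) (m : 'X_{1..n}) :
  i != j -> (a <= m i)%N -> (b <= m j)%N ->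
  exists2 q : {mpoly K[n]}, q \is (mdeg m - (a + b)).-homog &
    forall m', m' \in msupp ('X_[m] - ('X_i + 'X_j) ^+ (a + b) * q) ->
      mdeg m' = mdeg m /\ ~~ ((a <= m' i) && (b <= m' j))%N.
Proof.
move=> ne_ij le_ai le_bj; pose N := (m i + m j - (a + b))%N.
have [| g size_g coef_g] :=
    exists_mul_coef_window K charK (-1) a b N 'X^(m i).
  by rewrite oppr_eq0 oner_eq0.
pose m0 : 'X_{1..n} := [multinom if l \in [:: i; j] then 0%N else m l | l < n].
(* Here [T] is the joint degree in the two variables, [T - e] the exponent at
   [x_j]. *)
pose mon T e := (m0 + U_(i) *+ e + U_(j) *+ (T - e))%MM.
have mon_i T e : mon T e i = e.
  by rewrite !mnmE !inE eqxx /= !mulmnE !mnm1E eqxx eq_sym (negbTE ne_ij); lia.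
have mon_j T e : mon T e j = (T - e)%N.
  by rewrite !mnmE !inE eqxx orbT !mulmnE !mnm1E eqxx (negbTE ne_ij); lia.
have mdeg_mon T e : (e <= T)%N -> mdeg (mon T e) = (mdeg m0 + T)%N.
  by move=> le_eT; rewrite !mdegD !mdegMn !mdeg1 !mul1n -addnA subnKC.
have def_T : (m i + m j = (a + b) + N)%N by rewrite /N; lia.
have def_m : m = mon ((a + b) + N)%N (m i).
  apply/mnmP=> l; case: (eqVneq l i) => [-> | ne_li]; first by rewrite mon_i.
  case: (eqVneq l j) => [-> | ne_lj]; first by rewrite mon_j -def_T addKn.
  rewrite !mnmE !inE (negbTE ne_li) (negbTE ne_lj) /= !mulmnE !mnm1E.
  by rewrite eq_sym (negbTE ne_li) eq_sym (negbTE ne_lj) !addn0.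
have mdeg_m : mdeg m = (mdeg m0 + ((a + b) + N))%N.
  by rewrite {1}def_m mdeg_mon // -def_T leq_addr.
exists ('X_[m0] * homogenize 'X_i 'X_j N g).
  rewrite homogenizeX; apply: rpred_sum => e _; apply: rpredZ.
  rewrite dhomogX; apply/eqP; apply: etrans (mdeg_mon N e _) _.
    by rewrite -ltnS.
  by rewrite mdeg_m; lia.
pose r := 'X^(m i) - ('X - (-1)%:P) ^+ (a + b) * g.
(* The difference is the homogenization of the remainder [r], which vanishes
   on the window. *)
have -> : 'X_[m] - ('X_i + 'X_j) ^+ (a + b) *
      ('X_[m0] * homogenize 'X_i 'X_j N g) =
    \sum_(e < (a + b + N).+1)
        r`_e *: 'X_[mon (a + b + N)%N e].
  have -> : 'X_i + 'X_j = 'X_i - (-1) *: 'X_j :> {mpoly K[n]}.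
    by rewrite scaleN1r opprK.
  rewrite mulrCA -homogenize_XsubC_exp // homogenizeX.
  under [RHS]eq_bigr do rewrite /r coefB coefXn scalerBl.
  rewrite sumrB; congr (_ - _).
  have lt_mi : (m i < (a + b + N).+1)%N by lia.
  rewrite (bigD1 (Ordinal lt_mi)) //= eqxx scale1r -def_m big1 ?addr0 // => e.
  by rewrite -val_eqE /= => /negbTE ->; rewrite scale0r.
move=> m' /msupp_sum_le /flatten_mapP [e _].
case: (eqVneq (r`_e) 0) => [-> | nz_e]; first by rewrite scale0r msupp0.
move=> /msuppZ_le /mem_msuppXP <-.
rewrite mon_i mon_j mdeg_mon -1?ltnS //; split; first exact/esym.
apply: contra nz_e => /andP [le_ae le_be].
rewrite /r coefB coef_g ?subrr //; have := ltn_ord e; lia.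
Qed.

(** * Monomial ideals *)

Section MonomialIdeal.
Variables (K : fieldType) (n : nat).
Implicit Types (I : zmodClosed {mpoly K[n]}) (G : 'X_{1..n} -> Prop).

Lemma generated_by_msupp I G (p : {mpoly K[n]}) (m : 'X_{1..n}) :
  generated_by I G -> p \in I -> m \in msupp p ->
  exists2 g, G g & (g <= m)%MM.
Proof.
move=> genI /genI [s [sG ->]] /msupp_sum_le /flatten_mapP [u].
rewrite mem_filter => /sG [g Gg ->]; rewrite (perm_mem (msuppMX _ _)).
by case/mapP=> l _ ->; exists g; rewrite // lem_addr.
Qed.

Lemma generated_by_dvd I G (g m : 'X_{1..n}) :
  generated_by I G -> G g -> (g <= m)%MM -> 'X_[K, m] \in I.
Proof.
move=> genI Gg le_gm; apply/genI; exists [:: ('X_[m - g], 'X_[g])]; split.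
  by move=> u; rewrite inE => /eqP ->; exists g.
by rewrite big_seq1 -mpolyXD submK.
Qed.

Lemma monomial_ideal_mull I (p q : {mpoly K[n]}) :
  monomial_ideal I -> p \in I -> q * p \in I.
Proof.
case=> G genI /genI [s [sG ->]]; apply/genI.
exists [seq (q * u.1, u.2) | u <- s]; split.
  by move=> _ /mapP [u /sG ? ->].
by rewrite big_map mulr_sumr; apply: eq_bigr => u _; rewrite mulrA.
Qed.

Lemma monomial_idealP I (p : {mpoly K[n]}) :
  monomial_ideal I ->
  p \in I <-> (forall m, m \in msupp p -> 'X_[K, m] \in I).
Proof.
move=> monoI; split=> [Ip m supp_m | supp_p].
  have [G genI] := monoI.
  have [g Gg le_gm] := generated_by_msupp _ _ _ _ genI Ip supp_m.
  exact: generated_by_dvd genI Gg le_gm.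
rewrite (mpolyE p) big_seq; apply: rpred_sum => m /supp_p Im.
by rewrite -mul_mpolyC monomial_ideal_mull.
Qed.

Definition minimal_monomial I (m : 'X_{1..n}) : Prop :=
  'X_[K, m] \in I /\ forall g, (g <= m)%MM -> 'X_[K, g] \in I -> g = m.

Lemma minimal_monomial_below I (m : 'X_{1..n}) :
  'X_[K, m] \in I -> exists2 g, minimal_monomial I g & (g <= m)%MM.
Proof.
have [k] := ubnP (mdeg m); elim: k m => // k IHk m le_mk Im.
case: (boolP [exists g : 'X_{1..n < (mdeg m).+1},
    [&& (g <= m)%MM, 'X_[K, g] \in I & (bmnm g != m)]]) =>
    [/existsP | /existsPn].
  case=> g /and3P [le_gm Ig ne_gm].
  have lt_gm : (mdeg g < mdeg m)%N.
    rewrite ltnNge; apply: contra ne_gm => le_mg.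
    have : mdeg (m - g)%MM == 0%N.
      by have := congr1 mdeg (submK le_gm); rewrite mdegD; lia.
    rewrite mdeg_eq0 => /eqP mg0; apply/eqP.
    by have := submK le_gm; rewrite mg0 add0m.
  have [|g' min_g' le_g'g] := IHk g _ Ig; first by lia.
  by exists g' => //; apply: lepm_trans le_g'g le_gm.
move=> no_g; exists m; last exact: lepm_refl.
split=> // g le_gm Ig.
have mdeg_g : (mdeg g < (mdeg m).+1)%N.
  by rewrite ltnS -(submK le_gm) mdegD leq_addl.
by have := no_g (BMultinom mdeg_g); rewrite /= le_gm Ig negbK => /eqP.
Qed.

(** This is what gives access to the generating degree of [I], which is a
    condition on minimal generating sets only. *)
Lemma minimal_monomialP I :
  monomial_ideal I -> minimal_generators I (minimal_monomial I).
Proof.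
move=> monoI; split=> [p | G' subG' genI m min_m].
  split=> [Ip | [s [sG ->]]]; last first.
    rewrite big_seq; apply: rpred_sum => u /sG [g [Ig _] ->].
    exact: monomial_ideal_mull.
  have /(monomial_idealP _ _ monoI) {Ip} := Ip.
  rewrite {2}(mpolyE p); elim: (msupp p) => [|m s IHs] Is.
    by exists [::]; rewrite !big_nil.
  have [|t [tG def_s]] := IHs.
    by move=> l sl; apply: Is; rewrite inE sl orbT.
  have [g min_g le_gm] := minimal_monomial_below I m (Is m (mem_head _ _)).
  exists ((p@_m *: 'X_[m - g], 'X_[g]) :: t); split.
    by move=> u; rewrite inE => /orP [/eqP -> | /tG //]; exists g.
  by rewrite !big_cons /= -def_s -scalerAl -mpolyXD submK.
have [Im min_only] := min_m.
have [|g G'g le_gm] := generated_by_msupp I G' 'X_[m] m genI Im.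
  by apply/mem_msuppXP.
rewrite -(min_only g le_gm) //; apply: generated_by_dvd genI G'g _.
exact: lepm_refl.
Qed.

Lemma homog_lt_eq0 I (d e : nat) (p : {mpoly K[n]}) :
  monomial_ideal I -> generated_in_degree I d ->
  p \in I -> p \is e.-homog -> (e < d)%N -> p = 0.
Proof.
move=> monoI degI Ip /dhomogP homog_p lt_ed; apply/eqP.
rewrite -msupp_eq0 -size_eq0 -leqn0 leqNgt -has_predT.
apply/hasP=> -[m supp_m _].
have /minimal_monomial_below [g min_g le_gm] :=
  (monomial_idealP I p monoI).1 Ip m supp_m.
have := degI _ (minimal_monomialP I monoI) g min_g.
have := congr1 mdeg (submK le_gm); rewrite mdegD (homog_p m supp_m); lia.
Qed.

Lemma quot_mul_pi I (f p : {mpoly K[n]}) :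
  monomial_ideal I ->
  quot_mul f (\pi_{ideal_quot I} p)%qT = (\pi_{ideal_quot I} (f * p))%qT.
Proof.
move=> monoI; rewrite /quot_mul -lock; apply/eqP.
rewrite -Quotient.idealrBE -mulrBr; apply: monomial_ideal_mull => //.
by rewrite Quotient.idealrBE reprK.
Qed.

End MonomialIdeal.

(** * Maximal rank *)

Lemma homog_comp0 (K : fieldType) (n : nat) (k : int) :
  homog_comp k (0 : {mpoly K[n]}).
Proof. by case: k => [e|e] //=; apply: rpred0. Qed.

Lemma homog_comp_lin (K : fieldType) (n : nat) (k : int) (c : K)
    (p q : {mpoly K[n]}) :
  homog_comp k p -> homog_comp k q -> homog_comp k (c *: p + q).
Proof.
case: k => [e|e] /=; first by move=> ? ?; rewrite rpredD ?rpredZ.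
by move=> -> ->; rewrite scaler0 addr0.
Qed.

Lemma exists_mdeg_dvd (n d : nat) (m : 'X_{1..n}) :
  (d <= mdeg m)%N -> exists2 g, mdeg g = d & (g <= m)%MM.
Proof.
elim: d => [|d IHd] le_dm.
  by exists 0%MM; [apply: mdeg0 | apply/mnm_lepP=> l; rewrite mnm0E].
have [g mdeg_g le_gm] := IHd (ltnW le_dm).
have /existsP [l lt_gl] : [exists l, (g l < m l)%N].
  apply: contraLR le_dm => /existsPn le_mg; rewrite -ltnNge ltnS -mdeg_g.
  by rewrite !mdegE; apply: leq_sum => l _; rewrite leqNgt.
exists (g + U_(l))%MM; first by rewrite mdegD mdeg1 mdeg_g addn1.
apply/mnm_lepP=> l'; rewrite mnmDE mnm1E; case: eqVneq => [<- | _].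
  by rewrite addn1.
by rewrite addn0; exact: (mnm_lepP le_gm).
Qed.

Lemma mpolyX_addU_neq0 (K : fieldType) (n : nat) (i j : 'I_n) :
  i != j -> 'X_i + 'X_j != 0 :> {mpoly K[n]}.
Proof.
move=> ne_ij; apply/eqP=> /(congr1 (mcoeff U_(i))).
rewrite mcoeffD !mcoeffXU mcoeff0 eqxx eq_sym (negbTE ne_ij) addr0.
by apply/eqP; apply: oner_neq0.
Qed.

Theorem theorem3p8 (K : fieldType) (charK : [pchar K] =i pred0)
    (n d : nat) (I : zmodClosed {mpoly K[n]})
    (monoI : monomial_ideal I) (degI : generated_in_degree I d)
    (artI : artinian I)
    (i j : 'I_n) (ltij : (i < j)%N) (a b : nat)
    (divab : forall m : 'X_{1..n}, mdeg m = d -> 'X_[K, m] \notin I ->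
       (U_(i) *+ a + U_(j) *+ b <= m)%MM)
    (k : int) :
  mul_maximal_rank I (('X_i + 'X_j) ^+ (a + b)) (k - a%:Z - b%:Z) k.
Proof.
have ne_ij : i != j by rewrite -val_eqE /= neq_ltn ltij.
set f := ('X_i + 'X_j) ^+ (a + b).
have homog_f : f \is (a + b).-homog.
  rewrite -[(a + b)%N]mul1n; apply: dhomogMn.
  by apply: rpredD; rewrite dhomogX /= mdeg1.
have [[e -> le_de] | low_k] :
    (exists2 e, k = Posz e & (d <= e)%N) \/ (forall e, k = Posz e -> (e < d)%N).
- case: k => [e|e]; last by right.
  by case: (leqP d e) => [?|?]; [left; exists e | right=> _ [<-]].
- right=> _ [p homog_p ->].
  suff [q homog_q Iq] :
      exists2 q, homog_comp (Posz e - a%:Z - b%:Z) q & p - f * q \in I.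
    exists (\pi_{ideal_quot I} q)%qT; first by exists q.
    by rewrite quot_mul_pi //; apply/eqP; rewrite eq_sym -Quotient.idealrBE.
  rewrite (mpolyE p) big_seq; apply: (big_rec (fun p : {mpoly K[n]} =>
    exists2 q, homog_comp (Posz e - a%:Z - b%:Z) q & p - f * q \in I)).
    by exists 0; rewrite ?mulr0 ?subr0 ?rpred0 //; apply: homog_comp0.
  move=> m r supp_m [q homog_q Iq].
  have mdeg_m : mdeg m = e by move/dhomogP: homog_p => /(_ m supp_m).
  suff [q' homog_q' Iq'] : exists2 q', homog_comp (Posz e - a%:Z - b%:Z) q' &
      'X_[K, m] - f * q' \in I.
    exists (p@_m *: q' + q); first exact: homog_comp_lin.
    rewrite mulrDr opprD addrACA rpredD // -scalerAr -scalerBr -mul_mpolyC.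
    exact: monomial_ideal_mull.
  (* A divisor of degree exactly [d] is needed, as only there is membership
     in [I] controlled by divisibility by [x_i^a x_j^b]. *)
  have [g mdeg_g le_gm] : exists2 g, mdeg g = d & (g <= m)%MM.
    by apply: exists_mdeg_dvd; rewrite mdeg_m.
  rewrite -(submK le_gm) mpolyXD.
  case: (boolP ('X_[K, g] \in I)) => [Ig | nIg].
    exists 0; first exact: homog_comp0.
    by rewrite mulr0 subr0; apply: monomial_ideal_mull.
  have /mnm_lepP le_abg := divab g mdeg_g nIg.
  have le_ag : (a <= g i)%N.
    have := le_abg i; rewrite !mnmE !mulmnE !mnm1E eqxx; lia.
  have le_bg : (b <= g j)%N.
    have := le_abg j; rewrite !mnmE !mulmnE !mnm1E eqxx; lia.
  have [q' homog_q' supp_q'] :=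
    monomial_reduction K charK n i j a b g ne_ij le_ag le_bg.
  exists ('X_[m - g] * q').
    (* So the truncated [d - (a + b)] is the difference in the integers, and the
       source degree is not negative. *)
    have le_abd : (a + b <= d)%N.
      rewrite -mdeg_g mdegE (bigD1 i) //= (bigD1 j) ?(eq_sym j) //=; lia.
    have -> : (Posz e - a%:Z - b%:Z) = Posz (mdeg (m - g)%MM + (d - (a + b))).
      by have := congr1 mdeg (submK le_gm); rewrite mdegD mdeg_m mdeg_g; lia.
    by rewrite /homog_comp -mdeg_g; apply: dhomogM => //; rewrite dhomogX.
  rewrite mulrCA -mulrBr; apply: monomial_ideal_mull => //.
  apply/monomial_idealP=> // l supp_l.
  have [mdeg_l not_ab] := supp_q' l supp_l; apply: contraR not_ab => nIl.
  have /mnm_lepP le_abl := divab l (etrans mdeg_l mdeg_g) nIl.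
  have := le_abl i; have := le_abl j; rewrite !mnmE !mulmnE !mnm1E !eqxx; lia.
left=> _ _ [p homog_p ->] [q homog_q ->].
rewrite !quot_mul_pi // => /eqP; rewrite -Quotient.idealrBE -mulrBr => Ifpq.
congr (\pi_ _ _)%qT; apply/eqP; rewrite -subr_eq0.
have homog_pq : homog_comp (k - a%:Z - b%:Z) (p - q).
  have -> : p - q = (-1) *: q + p by rewrite scaleN1r addrC.
  exact: homog_comp_lin.
move def_s: (k - a%:Z - b%:Z) homog_pq => [s|s] /=; last by move=> ->.
move=> homog_pq; have def_k : k = Posz (a + b + s) by lia.
have := homog_lt_eq0 _ _ I d _ _ monoI degI Ifpq
  (dhomogM homog_f homog_pq) (low_k _ def_k).
move/eqP; rewrite mulf_eq0 expf_eq0.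
by rewrite (negbTE (mpolyX_addU_neq0 K n i j ne_ij)) andbF.
Qed.
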